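(* Let $n,k$ be positive integers and let $z:[n]\to[k]$ be any map (a $k$-coloring). Let $\mathcal M_{n,z}:=\{\gamma\in\ker_{\mathbb Z}A_{n,z}:\ \|\gamma\|_1=4\}$. Then $\mathcal M_{n,z}$ is a Markov basis for $A_{n,z}$. Moreover, every nonzero $\gamma\in\ker_{\mathbb Z}A_{n,z}$ satisfies $\|\gamma\|_1\ge 4$, i.e. the elements of $\mathcal M_{n,z}$ are exactly the elements of $\ker_{\mathbb Z}A_{n,z}$ of minimal (nonzero) 1-norm.
   Context: Coordinates of $\mathbb Z^{\binom n2}$ are indexed by the 2-subsets $\{u,v\}$ of $[n]=\{1,\dots,n\}$; write $\gamma_{uv}=\gamma_{vu}$ for the coordinate of $\{u,v\}$. $D_n$ is the $n\times\binom n2$ vertex-edge incidence matrix of the complete graph $K_n$. $C_z$ is the $\binom{k+1}{2}\times\binom n2$ matrix with rows indexed by pairs $(i,j)$, $1\le i\le j\le k$, whose column indexed by $\{u,v\}$ has a single entry $1$, in the row $(\min(z(u),z(v)),\max(z(u),z(v)))$, and zeros elsewhere. $A_{n,z}$ is the matrix obtained by stacking $D_n$ on top of $C_z$. Thus $\gamma\in\ker_{\mathbb Z}A_{n,z}$ iff $\sum_{u\ne v}\gamma_{uv}=0$ for every vertex $v$ and, for all $1\le i\le j\le k$, the sum of $\gamma_{uv}$ over all $\{u,v\}$ with $\{z(u),z(v)\}=\{i,j\}$ is $0$. For an integer matrix $A$ with $c$ columns and a vector $b$, the fiber is $\mathcal F_A(b)=\{x\in\mathbb N^c: Ax=b\}$.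 A finite set $\mathcal B\subset\ker_{\mathbb Z}A$ is a Markov basis for $A$ if for every $b$ the graph with vertex set $\mathcal F_A(b)$, in which $x,x'$ are adjacent iff $x-x'\in\mathcal B\cup(-\mathcal B)$, is connected. *)

(* Defs.v *)
From Stdlib Require Import Relation_Operators.
From HB Require Import structures.
From mathcomp Require Import all_boot all_order all_algebra.
From mathcomp Require Import classical_sets cardinality.

Set Implicit Arguments.
Unset Strict Implicit.
Unset Printing Implicit Defensive.

Import Order.TTheory GRing.Theory Num.Theory.
Local Open Scope classical_set_scope.
Local Open Scope ring_scope.

Definition norm1 (c : nat) (g : 'cV[int]_c) : int := \sum_(i < c) `|g i 0|.

Definition kerZ (m c : nat) (A : 'M[int]_(m, c)) : set 'cV[int]_c :=
  [set g | A *m g = 0].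

Definition intv (c : nat) (x : 'cV[nat]_c) : 'cV[int]_c := map_mx Posz x.

Definition fiber (m c : nat) (A : 'M[int]_(m, c)) (b : 'cV[int]_m) :
  set 'cV[nat]_c := [set x | A *m intv x = b].

Definition fiber_adj (m c : nat) (A : 'M[int]_(m, c)) (B : set 'cV[int]_c)
    (b : 'cV[int]_m) (x y : 'cV[nat]_c) : Prop :=
  [/\ fiber A b x, fiber A b y &
      B (intv x - intv y) \/ B (- (intv x - intv y))].

(* Empty fibers count as connected; since [fiber_adj] is symmetric, its
   reflexive transitive closure is connectedness by a path in the fiber. *)
Definition fiber_connected (m c : nat) (A : 'M[int]_(m, c))
    (B : set 'cV[int]_c) (b : 'cV[int]_m) : Prop :=
  forall x y : 'cV[nat]_c, fiber A b x -> fiber A b y ->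
    clos_refl_trans _ (fiber_adj A B b) x y.

Definition markov_basis (m c : nat) (A : 'M[int]_(m, c))
    (B : set 'cV[int]_c) : Prop :=
  [/\ finite_set B, B `<=` kerZ A &
      forall b : 'cV[int]_m, fiber_connected A B b].

(* Edges of the complete graph on 'I_n; matrix columns are numbered by
   [enum_val : 'I_#|{: edge n}| -> edge n]. *)
Definition edge (n : nat) := {e : {set 'I_n} | #|e| == 2%N}.

Definition color_pair (k : nat) := {p : 'I_k * 'I_k | (p.1 <= p.2)%N}.

Lemma card_edge (n : nat) : #|{: edge n}| = 'C(n, 2).
Proof.
by rewrite card_sig -[in RHS](card_ord n) -card_draws cardsE; apply: eq_card.
Qed.

Lemma card_color_pair (k : nat) : #|{: color_pair k}| = 'C(k.+1, 2).
Proof.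
rewrite card_sig -sum1_card big_mkcond /=.
rewrite -(pair_bigA _ (fun i j : 'I_k => if (i <= j)%N then 1%N else 0%N)) /=.
rewrite exchange_big /= -bin2_sum big_mkord big_ord_recl add0n.
apply: eq_bigr => j _; rewrite -big_mkcond /=.
rewrite -(big_ord_widen k (fun=> 1%N) (ltn_ord j)).
by rewrite sum1_card card_ord.
Qed.

Definition incidence_mx (n : nat) : 'M[int]_(n, #|{: edge n}|) :=
  \matrix_(v < n, e < #|{: edge n}|) (v \in val (enum_val e))%:R.

Definition color_mx (n k : nat) (z : 'I_n -> 'I_k) :
    'M[int]_(#|{: color_pair k}|, #|{: edge n}|) :=
  \matrix_(p < #|{: color_pair k}|, e < #|{: edge n}|)
    [exists u : 'I_n, exists v : 'I_n,
       (val (enum_val e) == [set u; v]%SET) &&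
       (val (enum_val p) == (Order.min (z u) (z v), Order.max (z u) (z v)))]%:R.

Definition Amx (n k : nat) (z : 'I_n -> 'I_k) :
    'M[int]_(n + #|{: color_pair k}|, #|{: edge n}|) :=
  col_mx (incidence_mx n) (color_mx z).

Definition minimal_moves (n k : nat) (z : 'I_n -> 'I_k) :
    set 'cV[int]_#|{: edge n}| :=
  [set g | kerZ (Amx z) g /\ norm1 g = 4].

(* Main.v *)
(* Write [g = x - y] for two points of a fiber, and call an edge positive or
   negative after the sign of [g]; both signs occur equally often at each vertex
   and for each pair of colors.  The moves of norm 4 are the swaps
   [ua, vd -> va, ud] with [z u = z v].  If some vertex [v] has a positive edge
   [va] and a negative edge [vb] with [z a = z b], a swap in [x] or in [y]
   shortens [g].  Otherwise take a positive [ua] and a negative [vb] with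
   [z u = z v] and [z a = z b]: a swap not lengthening [g] moves [ua] to [va]
   (in [x]) or [vb] to [ub] (in [y]) and leads to the first situation. *)
Require Import Defs.
From Stdlib Require Import Relation_Operators Operators_Properties.
From mathcomp Require Import all_boot all_order all_algebra.
From mathcomp Require Import classical_sets cardinality.
From mathcomp Require Import zify ring.
Import Order.TTheory GRing.Theory Num.Theory.
Local Open Scope ring_scope.

Set Implicit Arguments.
Unset Strict Implicit.
Unset Printing Implicit Defensive.

(** * The 1-norm on integer vectors and its change under a swap *)

Section Norm1.
Variable c : nat.
Implicit Types (g h : 'cV[int]_c) (e : 'I_c).

Lemma norm1_0 : norm1 (0 : 'cV[int]_c) = 0.
Proof. by apply: big1 => i _; rewrite mxE normr0. Qed.

Lemma norm1N g : norm1 (- g) = norm1 g.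
Proof. by apply: eq_bigr => i _; rewrite mxE normrN. Qed.

Lemma norm1_ge0 g : 0 <= norm1 g.
Proof. exact: sumr_ge0. Qed.

Lemma le_entry_norm1 g e : `|g e 0| <= norm1 g.
Proof. by rewrite /norm1 (bigD1 e) //= lerDl sumr_ge0. Qed.

Lemma nonzero_entry g : g <> 0 -> exists e, g e 0 < 0 \/ 0 < g e 0.
Proof.
move/eqP=> g0.
have [e /lt_total/orP ge] : exists e, g e 0 != 0; last by exists e.
apply/existsP; apply: contraNT g0; rewrite negb_exists => /forallP g0.
by apply/eqP/colP => e; rewrite mxE; have := g0 e; rewrite negbK => /eqP.
Qed.

(** Each entry lies between [-k] and [k], so shifting by [k] encodes the vectors by columns over the
    finite type ['I_(k + k).+1]. *)
Lemma finite_norm1_eq (k : nat) (A : set 'cV[int]_c) :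
  (forall g, A g -> norm1 g = k%:Z) -> finite_set A.
Proof.
move=> Ak.
pose f (s : 'cV['I_(k + k).+1]_c) : 'cV[int]_c :=
  map_mx (fun i : 'I_(k + k).+1 => i%:Z - k%:Z) s.
apply: (@sub_finite_set _ _ (f @` setT)%classic); last first.
  by apply: finite_image; apply: finite_finset.
move=> g /Ak gk; exists (map_mx (fun i => inord (absz (i + k%:Z))) g) => //.
apply/colP => e; rewrite !mxE.
have := le_entry_norm1 g e; rewrite gk; move: (g e 0) => t t_le.
by rewrite inordK; lia.
Qed.

Definition swap e1 e2 e3 e4 : 'cV[int]_c :=
  delta_mx e1 0 + delta_mx e2 0 - delta_mx e3 0 - delta_mx e4 0.

Lemma swapE e1 e2 e3 e4 e : swap e1 e2 e3 e4 e 0 =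
  (e == e1)%:R + (e == e2)%:R - (e == e3)%:R - (e == e4)%:R.
Proof. by rewrite !mxE !eqxx !andbT. Qed.

Lemma sum_swap (F : 'I_c -> int) e1 e2 e3 e4 :
  \sum_e F e * swap e1 e2 e3 e4 e 0 = F e1 + F e2 - F e3 - F e4.
Proof.
have sumF e' : \sum_e F e * (e == e')%:R = F e'.
  rewrite (bigD1 e') //= eqxx mulr1 big1 ?addr0 // => e /negPf->.
  by rewrite mulr0.
rewrite -[in RHS]sumF -[F e2]sumF -[F e3]sumF -[F e4]sumF.
rewrite -big_split -!sumrB; apply: eq_bigr => e _ /=.
by rewrite swapE; ring.
Qed.

(** Since the four coordinates are distinct, each moves by exactly one and contributes separately.
    In applications the signs of [g] at three of them force a drop there, and the fourth costs at
    most 1. *)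
Lemma norm1_addswap g e1 e2 e3 e4 : uniq [:: e1; e2; e3; e4] ->
  norm1 (g + swap e1 e2 e3 e4) = norm1 g
    + (`|g e1 0 + 1| - `|g e1 0|) + (`|g e2 0 + 1| - `|g e2 0|)
    + (`|g e3 0 - 1| - `|g e3 0|) + (`|g e4 0 - 1| - `|g e4 0|).
Proof.
rewrite /= !inE !negb_or andbT => /andP[/and3P[n12 n13 n14]].
move=> /andP[/andP[n23 n24] n34].
have splitE (F : 'I_c -> int) : \sum_e F e = F e1 + (F e2 + (F e3 + (F e4 +
    \sum_(e | [&& e != e1, e != e2, e != e3 & e != e4]) F e))).
  rewrite (bigD1 e1) //= (bigD1 e2) 1?eq_sym //=.
  rewrite (bigD1 e3) /=; last by rewrite ![e3 == _]eq_sym n13 n23.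
  rewrite (bigD1 e4) /=; last by rewrite ![e4 == _]eq_sym n14 n24 n34.
  by do 4!congr (_ + _); apply: eq_bigl => e; rewrite -!andbA.
rewrite /norm1 !splitE.
rewrite [X in _ + (_ + (_ + (_ + X))) = _](eq_bigr (fun e => `|g e 0|)).
  rewrite 4![(g + _) _ _]mxE !swapE !eqxx.
  rewrite ![e4 == _]eq_sym ![e3 == e1]eq_sym ![e3 == e2]eq_sym [e2 == e1]eq_sym.
  rewrite (negPf n12) (negPf n13) (negPf n14) (negPf n23) (negPf n24) (negPf n34).
  by rewrite !mulr1n !mulr0n !(subr0, sub0r, addr0, add0r); ring.
move=> e /and4P[/negPf m1 /negPf m2 /negPf m3 /negPf m4].
by rewrite mxE swapE m1 m2 m3 m4 !(subr0, addr0).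
Qed.

Lemma norm1_swap e1 e2 e3 e4 : uniq [:: e1; e2; e3; e4] ->
  norm1 (swap e1 e2 e3 e4) = 4.
Proof.
by move=> u; rewrite -[swap _ _ _ _]add0r norm1_addswap // norm1_0 !mxE; lia.
Qed.

End Norm1.

(** * Column indices as edges of the complete graph *)

Section Edges.
Variable n : nat.
Local Notation E := #|{: edge n}|.
Implicit Types (e : 'I_E) (u v : 'I_n).

Definition ends e : {set 'I_n} := val (enum_val e).

Lemma ends_inj : injective ends.
Proof. by move=> e e' /val_inj/enum_val_inj. Qed.

Lemma ends_nonempty e : exists u, u \in ends e.
Proof. by apply/card_gt0P; rewrite (eqP (valP (enum_val e))). Qed.

Lemma endsP e u : u \in ends e -> exists2 v, u != v & ends e = [set u; v]%SET.
Proof.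
move=> ue; have := valP (enum_val e); rewrite -/(ends e) /= (cardsD1 u) ue.
rewrite eqSS => /cards1P[v ve]; exists v; last by rewrite -ve finset.setD1K.
by move/setP/(_ v): ve; rewrite !inE eqxx eq_sym => /andP[].
Qed.

Lemma ends_exists u v : u != v -> exists e, ends e = [set u; v]%SET.
Proof.
move=> uv; have c2 : #|[set u; v]%SET| == 2%N by rewrite cards2 uv.
by exists (enum_rank (Sub [set u; v]%SET c2 : edge n)); rewrite /ends enum_rankK.
Qed.

Lemma ends_neq e u v : ends e = [set u; v]%SET -> u != v.
Proof.
move=> eE; have := valP (enum_val e); rewrite -/(ends e) /= eE cards2.
by case: (u != v).
Qed.

End Edges.

Lemma set2_eq (T : finType) (a b c d : T) : [set a; b]%SET = [set c; d]%SET ->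
  (a = c /\ b = d) \/ (a = d /\ b = c).
Proof.
move=> eq2; have := set21 a b; have := set22 a b; rewrite eq2 !inE.
have := set21 c d; have := set22 c d; rewrite -eq2 !inE.
by do 4!case/orP=> /eqP ?; subst; auto.
Qed.

(** * The integer kernel: sign balance at vertices and at color pairs *)

Section Moves.
Variables (n k : nat) (z : 'I_n -> 'I_k).
Local Notation E := #|{: edge n}|.
Implicit Types (g h : 'cV[int]_E) (e : 'I_E) (u v a b : 'I_n).

Lemma kerP g : kerZ (Amx z) g <->
  (forall v, \sum_e (v \in ends e)%:R * g e 0 = 0) /\
  (forall p, \sum_e color_mx z p e * g e 0 = 0).
Proof.
have degE v : \sum_e (v \in ends e)%:R * g e 0 = (incidence_mx n *m g) v 0.
  by rewrite mxE; apply: eq_bigr => e _; rewrite mxE.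
rewrite /kerZ /Amx /= mul_col_mx -[X in _ = X <-> _]col_mx0; split.
  case/eq_col_mx => d0 c0; split=> [v|p]; first by rewrite degE d0 mxE.
  by have := congr1 (fun M : 'cV_ _ => M p 0) c0; rewrite !mxE.
case=> d0 c0; congr col_mx; apply/colP => i; first by rewrite -degE d0 mxE.
by rewrite mxE c0 mxE.
Qed.

Lemma kerN g : kerZ (Amx z) g -> kerZ (Amx z) (- g).
Proof. by rewrite /kerZ /= mulmxN => ->; rewrite oppr0. Qed.

Lemma kerD g h : kerZ (Amx z) g -> kerZ (Amx z) h -> kerZ (Amx z) (g + h).
Proof. by rewrite /kerZ /= mulmxDr => -> ->; rewrite addr0. Qed.

Lemma color_mxE p e u v : ends e = [set u; v]%SET ->
  color_mx z p e =
  (val (enum_val p) == (Order.min (z u) (z v), Order.max (z u) (z v)))%:R.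
Proof.
move=> eE; rewrite mxE; congr (_%:R); congr nat_of_bool.
apply/existsP/idP => [[u' /existsP[v' /andP[/eqP]]]|pE].
  rewrite -[val _]/(ends e) eE => /set2_eq[][-> ->] //.
  by rewrite minC maxC.
by exists u; apply/existsP; exists v; rewrite -[val _]/(ends e) eE eqxx.
Qed.

(** Without a negative entry on [P] all terms of the sum would be nonnegative, hence zero, against
    [0 < g e 0]. Vertex rows and color rows are both treated through this one statement. *)
Lemma exists_neg (P : pred 'I_E) g e :
  \sum_e' (P e')%:R * g e' 0 = 0 -> P e -> 0 < g e 0 ->
  exists2 e', P e' & g e' 0 < 0.
Proof.
move=> sum0 Pe ge; case: (pickP [pred e' | P e' & g e' 0 < 0]) => [e'|none].
  by case/andP=> *; exists e'.
have ge0 e' : true -> 0 <= (P e')%:R * g e' 0.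
  move=> _; have := none e'; rewrite /=.
  by case: (P e') => /= [|_]; rewrite ?mul0r // mul1r; lia.
have := psumr_eq0P ge0 sum0 (i := e) isT.
by rewrite Pe mul1r => g0; rewrite g0 in ge.
Qed.

Lemma neg_incident g e u : kerZ (Amx z) g -> u \in ends e -> 0 < g e 0 ->
  exists e' v, ends e' = [set u; v]%SET /\ g e' 0 < 0.
Proof.
case/kerP => deg _ ue ge; have [e' /endsP[v _ e'E] ge'] := exists_neg (deg u) ue ge.
by exists e', v.
Qed.

Lemma pos_incident g e u : kerZ (Amx z) g -> u \in ends e -> g e 0 < 0 ->
  exists e' v, ends e' = [set u; v]%SET /\ 0 < g e' 0.
Proof.
move=> /kerN kg ue ge; have [|e' [v [e'E]]] := neg_incident kg ue.
  by rewrite mxE oppr_gt0.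
by rewrite mxE oppr_lt0; exists e', v.
Qed.

(** The row of the color pair of [e] sums to zero and has a positive term. Color pairs are
    unordered, so the ends of the negative edge found are named [v], [b] in whichever order matches
    [u], [a]. *)
Lemma neg_same_colors g e u a :
  kerZ (Amx z) g -> ends e = [set u; a]%SET -> 0 < g e 0 ->
  exists e' v b,
    [/\ ends e' = [set v; b]%SET, z v = z u, z b = z a & g e' 0 < 0].
Proof.
case/kerP => _ col eE ge.
have le_mM : (Order.min (z u) (z a) <= Order.max (z u) (z a))%N.
  by case: (leP (z u) (z a)) => // /ltW.
pose p : color_pair k := Sub (Order.min (z u) (z a), Order.max (z u) (z a)) le_mM.
pose i := enum_rank p.
have col' e' u' v' : ends e' = [set u'; v']%SET -> color_mx z i e' =
    ((Order.min (z u) (z a), Order.max (z u) (z a)) ==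
     (Order.min (z u') (z v'), Order.max (z u') (z v')))%:R.
  by move/(color_mxE i)->; rewrite enum_rankK.
(* Entries of [color_mx] are 0 or 1, so the row is the indicator of a predicate, as [exists_neg]
   requires. *)
have sum0 : \sum_e' (color_mx z i e' != 0)%:R * g e' 0 = 0.
  rewrite -[RHS](col i); apply: eq_bigr => e' _; congr (_ * _).
  by rewrite mxE; case: [exists _, _].
have [|e' + ge'] := exists_neg sum0 _ ge; first by rewrite (col' _ _ _ eE) eqxx.
have [v /endsP[b vb e'E]] := ends_nonempty e'.
rewrite (col' _ _ _ e'E) pnatr_eq0 eqb0 negbK => /eqP[].
case: (leP (z u) (z a)) => _; case: (leP (z v) (z b)) => _ mE ME.
- by exists e', v, b.
- by exists e', b, v; rewrite finset.setUC.
- by exists e', b, v; rewrite finset.setUC.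
- by exists e', v, b.
Qed.

(** * Swaps along a 4-cycle as kernel elements of norm 4 *)

Section Swap.
Variables (u v a d : 'I_n) (e1 e2 e3 e4 : 'I_E).
Hypotheses (e1E : ends e1 = [set v; a]%SET) (e2E : ends e2 = [set u; d]%SET).
Hypotheses (e3E : ends e3 = [set u; a]%SET) (e4E : ends e4 = [set v; d]%SET).
Hypotheses (uv : u != v) (ad : a != d).

Lemma swap_uniq : uniq [:: e1; e2; e3; e4].
Proof.
have [va ud] := (ends_neq e1E, ends_neq e2E).
have [ua vd] := (ends_neq e3E, ends_neq e4E).
rewrite /= !inE !negb_or andbT -!andbA.
by do 5?[apply/andP; split]; apply/eqP => /(congr1 (@ends n));
  rewrite ?(e1E, e2E, e3E, e4E) => /set2_eq[][? ?]; subst;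
  move: uv ad va ud ua vd; rewrite ?eqxx.
Qed.

(** Signs alternate along the cycle va, au, ud, dv, so they cancel at each vertex. As [z u = z v],
    the edges va, ua have the same color pair, and so do ud, vd; each such pair carries opposite
    signs. *)
Lemma swap_minimal : z u = z v -> minimal_moves z (swap e1 e2 e3 e4).
Proof.
move=> zuv; split; last exact: norm1_swap swap_uniq.
apply/kerP; split=> [w|p]; rewrite sum_swap.
  have incE x y : x != y ->
      (w \in [set x; y]%SET)%:R = (w == x)%:R + (w == y)%:R :> int.
    move=> xy; rewrite !inE; case: (eqVneq w x) => [->|_].
      by rewrite (negPf xy).
    by rewrite add0r.
  rewrite e1E e2E e3E e4E !incE ?(ends_neq e1E) ?(ends_neq e2E) //.
  - by ring.
  - exact: ends_neq e4E.
  - exact: ends_neq e3E.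
rewrite (color_mxE p e1E) (color_mxE p e2E) (color_mxE p e3E) (color_mxE p e4E).
by rewrite zuv; ring.
Qed.

End Swap.

(** * Steps on differences, and chains of steps that lower the norm *)

(* When [g = x - y] with [x] and [y] nonnegative, the first alternative keeps
   [x + (g' - g)] nonnegative and the second one [y - (g' - g)]. *)
Definition step g g' := minimal_moves z (g' - g) /\
  ((forall e, Order.min 0 (g e 0) <= g' e 0) \/
   (forall e, g' e 0 <= Order.max 0 (g e 0))).

(** Negation exchanges the roles of [x] and [y], hence the two alternatives of [step]. *)
Lemma stepN g g' : step g g' -> step (- g) (- g').
Proof.
case=> -[kg ng] sg; split.
  by rewrite -opprD; split; [apply: kerN | rewrite norm1N].
by case: sg => sg; [right | left] => e; have := sg e; rewrite !mxE;
  move: (g e 0) (g' e 0) => s t; lia.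
Qed.

Lemma step_swap_pos g e1 e2 e3 e4 : minimal_moves z (swap e1 e2 e3 e4) ->
  uniq [:: e1; e2; e3; e4] ->
  0 < g e3 0 -> 0 < g e4 0 -> step g (g + swap e1 e2 e3 e4).
Proof.
move=> mm /= un g3 g4; split; first by rewrite addrC addKr.
left=> e; rewrite mxE swapE; move: un g3 g4; rewrite !inE.
case: (eqVneq e e1) => [?|_]; case: (eqVneq e e2) => [?|_];
  case: (eqVneq e e3) => [?|_]; case: (eqVneq e e4) => [?|_]; subst;
  by rewrite ?eqxx ?orbT ?andbF //=; lia.
Qed.

Lemma step_swap_neg g e1 e2 e3 e4 : minimal_moves z (swap e1 e2 e3 e4) ->
  uniq [:: e1; e2; e3; e4] ->
  g e1 0 < 0 -> g e2 0 < 0 -> step g (g + swap e1 e2 e3 e4).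
Proof.
move=> mm /= un g1 g2; split; first by rewrite addrC addKr.
right=> e; rewrite mxE swapE; move: un g1 g2; rewrite !inE.
case: (eqVneq e e1) => [?|_]; case: (eqVneq e e2) => [?|_];
  case: (eqVneq e e3) => [?|_]; case: (eqVneq e e4) => [?|_]; subst;
  by rewrite ?eqxx ?orbT ?andbF //=; lia.
Qed.

(** Balance at [b] gives a positive edge bw. Trading va, bw for vb, aw gains 1 at each of va, bw, vb
    and loses at most 1 at aw. *)
Lemma descend_same_vertex g v a b e1 e2 : kerZ (Amx z) g ->
  ends e1 = [set v; a]%SET -> ends e2 = [set v; b]%SET -> z a = z b ->
  0 < g e1 0 -> g e2 0 < 0 ->
  exists2 g', step g g' & norm1 g' < norm1 g.
Proof.
move=> kg e1E e2E zab g1 g2.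
have ab : a != b.
  apply/eqP => ab; have e12 : e1 = e2 by apply: ends_inj; rewrite e1E ab e2E.
  by move: g2; rewrite -e12; lia.
have be2 : b \in ends e2 by rewrite e2E set22.
have ae1 : a \in ends e1 by rewrite e1E set22.
have [e3 [w [e3E g3]]] := pos_incident kg be2 g2.
have vw : v != w.
  apply/eqP => vw; have e32 : e3 = e2 by apply: ends_inj; rewrite e3E -vw finset.setUC.
  by move: g2; rewrite -e32; lia.
rewrite finset.setUC in e1E; rewrite finset.setUC in e2E.
have [wa|aw] := eqVneq a w; last first.
  have [e4 e4E] := ends_exists aw.
  have un := swap_uniq e2E e4E e1E e3E ab vw.
  have mm := swap_minimal e2E e4E e1E e3E ab vw zab.
  exists (g + swap e2 e4 e1 e3); first exact: step_swap_pos.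
  by rewrite norm1_addswap //; lia.
(* Now bw is the edge ab and aw would be a loop. A negative edge ax replaces it: raising the
   negative vb, ax and lowering va, bx again shortens [g], this time by a move in [y]. *)
have [e4 [x [e4E g4]]] := neg_incident kg ae1 g1.
have vx : v != x.
  apply/eqP => vx; have e41 : e4 = e1 by apply: ends_inj; rewrite e4E -vx e1E.
  by move: g4; rewrite e41; lia.
have bx : b != x.
  apply/eqP => bx; have e43 : e4 = e3.
    by apply: ends_inj; rewrite e4E e3E -bx -wa finset.setUC.
  by move: g4; rewrite e43; lia.
have [e5 e5E] := ends_exists bx.
have un := swap_uniq e2E e4E e1E e5E ab vx.
have mm := swap_minimal e2E e4E e1E e5E ab vx zab.
exists (g + swap e2 e4 e1 e5); first exact: step_swap_neg.
by rewrite norm1_addswap //; lia.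
Qed.

(** A chain is allowed because a single swap may leave the norm unchanged; only its end has to be
    shorter. *)
Definition descends g :=
  exists2 g', clos_refl_trans _ step g g' & norm1 g' < norm1 g.

Lemma descendsN g : descends (- g) -> descends g.
Proof.
case=> g' st; rewrite norm1N => lt_g; exists (- g'); last by rewrite norm1N.
rewrite -[g]opprK; elim: st => [x y /stepN|x|x y w _ IH1 _ IH2].
- exact: rt_step.
- exact: rt_refl.
- exact: rt_trans IH1 IH2.
Qed.

(* The swap [ua, vd -> va, ud] need not shorten [g], but it makes [va] positive
   next to the negative [vb]. *)
Lemma descend_transfer g u v a b d e1 e2 e3 : kerZ (Amx z) g ->
  ends e1 = [set u; a]%SET -> ends e2 = [set v; b]%SET ->
  ends e3 = [set v; d]%SET -> z u = z v -> z a = z b ->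
  u != v -> v != a -> u != b -> u != d ->
  0 < g e1 0 -> g e2 0 < 0 -> 0 < g e3 0 -> descends g.
Proof.
move=> kg e1E e2E e3E zuv zab uv va ub ud g1 g2 g3.
have good g' e e' w x y : kerZ (Amx z) g' -> ends e = [set w; x]%SET ->
    ends e' = [set w; y]%SET -> z x = z y -> 0 < g' e 0 -> g' e' 0 < 0 ->
    exists2 g'', clos_refl_trans _ step g' g'' & norm1 g'' < norm1 g'.
  move=> kg' eE e'E zxy ge ge'.
  by have [g'' st lt_g] := descend_same_vertex kg' eE e'E zxy ge ge';
    exists g'' => //; apply: rt_step.
have [e4 e4E] := ends_exists va.
have [e5 e5E] := ends_exists ud.
(* If va is negative it clashes with ua at [a]; if positive, with vb at [v]. Only the value 0 calls
   for the swap. *)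
case: (ltrgtP (g e4 0) 0) => g4.
- rewrite finset.setUC in e1E; rewrite finset.setUC in e4E.
  exact: good kg e1E e4E zuv g1 g4.
- exact: good kg e4E e2E zab g4 g2.
have ad : a != d.
  apply/eqP => ad; have e34 : e3 = e4 by apply: ends_inj; rewrite e3E -ad e4E.
  by move: g3; rewrite e34 g4.
have un := swap_uniq e4E e5E e1E e3E uv ad.
have mm := swap_minimal e4E e5E e1E e3E uv ad zuv.
set g' := g + swap e4 e5 e1 e3.
have kg' : kerZ (Amx z) g' by apply: kerD => //; case: mm.
(* The positive ua and vd each gain 1, while va and ud each cost at most 1. *)
have le_g : norm1 g' <= norm1 g by rewrite norm1_addswap //; lia.
(* The edge vb stays negative because it is neither of the two raised edges va, ud. *)
have e42 : e4 != e2 by apply/eqP => e42; move: g2; rewrite -e42 g4.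
have e52 : e2 != e5.
  apply/eqP => /(congr1 (@ends n)); rewrite e2E e5E => /set2_eq[][? ?]; subst.
    by rewrite eqxx in uv.
  by rewrite eqxx in ub.
have g'4 : 0 < g' e4 0.
  move: un; rewrite /= !inE !negb_or => /andP[/and3P[n1 n2 n3] _].
  rewrite mxE swapE g4 eqxx (negPf n1) (negPf n2) (negPf n3); lia.
have g'2 : g' e2 0 < 0.
  rewrite mxE swapE (negPf e52) [e2 == e4]eq_sym (negPf e42).
  by move: (g e2 0) g2 => t; case: (e2 == e1); case: (e2 == e3); lia.
have [g'' st lt_g] := good _ _ _ _ _ _ kg' e4E e2E zab g'4 g'2.
exists g''; last exact: lt_le_trans le_g.
by apply: rt_trans st; apply: rt_step; apply: step_swap_pos.
Qed.

(** The color equations pair the positive edge ua with a negative edge vb of matching colors. If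
    [u = v], [u = b] or [v = a], both edges meet at a vertex with equally colored other ends;
    otherwise [descend_transfer] brings about such a meeting. *)
Lemma ker_descends_pos g e : kerZ (Amx z) g -> 0 < g e 0 -> descends g.
Proof.
move=> kg g1; have [u ue] := ends_nonempty e.
have [a ua e1E] := endsP ue.
have good w x y e' : ends e = [set w; x]%SET -> ends e' = [set w; y]%SET ->
    z x = z y -> g e' 0 < 0 -> descends g.
  move=> eE e'E zxy ge'.
  have [g' st lt_g] := descend_same_vertex kg eE e'E zxy g1 ge'.
  by exists g' => //; apply: rt_step.
have [e2 [v [b [e2E zvu zba g2]]]] := neg_same_colors kg e1E g1.
have [uv|uv] := eqVneq u v; first by subst v; apply: good e1E e2E _ g2.
have [ub|ub] := eqVneq u b.
  subst b; rewrite finset.setUC in e2E.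
  by apply: good e1E e2E _ g2; rewrite zvu.
have [va|va] := eqVneq v a.
  subst v; rewrite finset.setUC in e1E.
  by apply: good e1E e2E _ g2; rewrite zba.
have [|e3 [d [e3E g3]]] := pos_incident kg (e := e2) (u := v) _ g2.
  by rewrite e2E set21.
have [ud|ud] := eqVneq u d; last first.
  exact: (@descend_transfer g u v a b d e e2 e3).
(* All we know about [v] is its positive edge [uv]: play on the other side. *)
have [e4 [c [e4E g4]]] := neg_incident kg ue g1.
have vc : v != c.
  apply/eqP => vc; have e34 : e3 = e4.
    by apply: ends_inj; rewrite e3E e4E -ud -vc finset.setUC.
  by move: g4; rewrite -e34; lia.
(* In [- g] the edge vb is positive, ua is negative, and uc is positive and serves as the third
   edge; [vc] holds since uv and uc have opposite signs in [g]. *)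
apply: descendsN; apply: (@descend_transfer _ v u b a c e2 e e4) => //.
- exact: kerN.
- by rewrite eq_sym.
- by rewrite mxE oppr_gt0.
- by rewrite mxE oppr_lt0.
- by rewrite mxE oppr_gt0.
Qed.

Lemma ker_descends g : kerZ (Amx z) g -> g <> 0 -> descends g.
Proof.
move=> kg /nonzero_entry[e [lt0|gt0]].
  apply: descendsN; apply: (@ker_descends_pos _ e); first exact: kerN.
  by rewrite mxE oppr_gt0.
exact: ker_descends_pos gt0.
Qed.

(** * The least norm of a nonzero kernel element *)

Lemma ker_minimal_move g : kerZ (Amx z) g -> g <> 0 ->
  exists h, minimal_moves z h.
Proof.
move=> kg g0; have [g' st] := ker_descends kg g0.
(* The norm drops strictly, so the chain is not empty, and its first step supplies the move. *)
by case: (clos_rt_rt1n _ _ _ _ st) => [|x y [mx _] _ _]; [rewrite ltxx | exists (x - g)].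
Qed.

(** A positive edge ua forces negative edges uc and ad, which differ since [c] is not [a]. Balance
    at [c] then forces a second positive edge: four distinct nonzero entries. *)
Lemma ker_norm1_ge4 g : kerZ (Amx z) g -> g <> 0 -> 4 <= norm1 g.
Proof.
have pos h e : kerZ (Amx z) h -> 0 < h e 0 -> 4 <= norm1 h.
  move=> kh h1; have [u ue] := ends_nonempty e.
  have [a ua eE] := endsP ue.
  have ae : a \in ends e by rewrite eE set22.
  have [e2 [c [e2E h2]]] := neg_incident kh ue h1.
  have [e3 [d [e3E h3]]] := neg_incident kh ae h1.
  have ca : a != c.
    apply/eqP => ac; have ee2 : e = e2 by apply: ends_inj; rewrite eE ac e2E.
    by move: h2; rewrite -ee2; lia.
  have ce2 : c \in ends e2 by rewrite e2E set22.
  have [e4 [f [e4E h4]]] := pos_incident kh ce2 h2.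
  have ee4 : e4 != e.
    apply/eqP => /(congr1 (@ends n)); rewrite e4E eE => /set2_eq[][? ?]; subst.
      by have := ends_neq e2E; rewrite eqxx.
    by rewrite eqxx in ca.
  have ee23 : e3 != e2.
    apply/eqP => /(congr1 (@ends n)); rewrite e3E e2E => /set2_eq[][? ?]; subst.
      by rewrite eqxx in ua.
    by rewrite eqxx in ca.
  have pn e' e'' : 0 < h e' 0 -> h e'' 0 < 0 -> e'' != e'.
    by move=> p m; apply/eqP => q; move: m; rewrite q; lia.
  rewrite /norm1 (bigD1 e) //= (bigD1 e4) //= (bigD1 e2) ?pn //=.
  rewrite (bigD1 e3) ?ee23 ?pn //=.
  set r := \sum_(i < _ | _) _; have r0 : 0 <= r by apply: sumr_ge0.
  move: r r0 (h e 0) h1 (h e2 0) h2 (h e3 0) h3 (h e4 0) h4 => *; lia.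
move=> kg /nonzero_entry[e [lt0|gt0]].
  rewrite -norm1N; apply: (@pos _ e); first exact: kerN.
  by rewrite mxE oppr_gt0.
exact: pos gt0.
Qed.

(** * From steps on differences to paths in a fiber *)

Section Fiber.
Variable b : 'cV[int]_(n + #|{: color_pair k}|).
Implicit Types x y : 'cV[nat]_E.

Definition linked x y :=
  clos_refl_trans _ (fiber_adj (Amx z) (minimal_moves z) b) x y.

Lemma linked_sym x y : linked x y -> linked y x.
Proof.
elim=> [s t [fs ft st]|s|s t r _ IH1 _ IH2].
- apply: rt_step; split=> //.
  by rewrite -[intv t - _]opprB opprK; case: st; [right | left].
- exact: rt_refl.
- exact: rt_trans IH2 IH1.
Qed.

Lemma linked_fiber x y : linked x y -> fiber (Amx z) b x -> fiber (Amx z) b y.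
Proof. by elim=> [s t []|s|s t r _ IH1 _ IH2 /IH1/IH2]. Qed.

Lemma fiber_move x h : fiber (Amx z) b x -> minimal_moves z h ->
  (forall e, 0 <= (intv x + h) e 0) ->
  exists2 x', linked x x' & intv x' = intv x + h.
Proof.
move=> fx mh x0; pose x' := map_mx absz (intv x + h).
have x'E : intv x' = intv x + h.
  by apply/colP => e; rewrite 2!mxE gez0_abs.
exists x' => //; apply: rt_step; split=> //.
  by rewrite /fiber /= x'E mulmxDr fx; case: mh => ->; rewrite addr0.
by right; rewrite x'E opprB addrC addKr.
Qed.

Lemma step_lift x y g' : fiber (Amx z) b x -> fiber (Amx z) b y ->
  step (intv x - intv y) g' ->
  exists x' y', [/\ linked x x', linked y y' & intv x' - intv y' = g'].
Proof.
move=> fx fy [mh]; set h := g' - _ in mh; have g'E : g' = intv x - intv y + h.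
  by rewrite addrC subrK.
have mN : minimal_moves z (- h).
  by case: mh => kh nh; split; [apply: kerN | rewrite norm1N].
case=> sg.
  have [|x' xx' x'E] := fiber_move fx mh.
    (* Entrywise, [x + h = y + g'] is at least the minimum of [x] and [y], hence nonnegative; below,
       the same bound holds for [y - h = x - g']. *)
    by move=> e; have := sg e; rewrite g'E !mxE; lia.
  by exists x', y; split=> //; [apply: rt_refl | rewrite x'E g'E addrAC].
have [|y' yy' y'E] := fiber_move fy mN.
  by move=> e; have := sg e; rewrite g'E !mxE; lia.
exists x, y'; split=> //; first exact: rt_refl.
by rewrite y'E g'E opprD opprK addrA.
Qed.

Lemma steps_lift x y g' : fiber (Amx z) b x -> fiber (Amx z) b y ->
  clos_refl_trans _ step (intv x - intv y) g' ->
  exists x' y', [/\ linked x x', linked y y' & intv x' - intv y' = g'].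
Proof.
move=> fx fy st; move: (clos_rt_rt1n _ _ _ _ st) => {st}.
move gE: (intv x - intv y) => g st.
elim: st x y fx fy gE => {g g'} [g|g g1 g' sg _ IH] x y fx fy gE.
  by exists x, y; split=> //; apply: rt_refl.
rewrite -gE in sg; have [x1 [y1 [xx1 yy1 x1E]]] := step_lift fx fy sg.
have [x2 [y2 [xx2 yy2 x2E]]] :=
  IH _ _ (linked_fiber xx1 fx) (linked_fiber yy1 fy) x1E.
by exists x2, y2; split=> //; [apply: rt_trans xx2 | apply: rt_trans yy2].
Qed.

Lemma fiber_linked x y : fiber (Amx z) b x -> fiber (Amx z) b y -> linked x y.
Proof.
have [N] := ubnP (absz (norm1 (intv x - intv y))).
elim: N x y => // N IH x y ltN fx fy.
have [xy0|/eqP xy0] := eqVneq (intv x - intv y) 0.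
  suff -> : x = y by apply: rt_refl.
  by apply/colP => e; have := congr1 (fun M : 'cV_ _ => M e 0) xy0;
    rewrite !mxE; lia.
have [|g' st lt_g] := ker_descends _ xy0.
  by rewrite /kerZ /= mulmxBr fx fy subrr.
have [x' [y' [xx' yy' x'E]]] := steps_lift fx fy st.
suff x'y' : linked x' y'.
  by apply: (rt_trans _ _ _ _ _ xx'); apply: rt_trans x'y' (linked_sym yy').
apply: IH; [|exact: linked_fiber xx' fx|exact: linked_fiber yy' fy].
by have := norm1_ge0 g'; rewrite x'E; lia.
Qed.

End Fiber.

End Moves.

Local Open Scope classical_set_scope.
Local Open Scope ring_scope.

Theorem theorem1p1 (n k : nat) (n_gt0 : (0 < n)%N) (k_gt0 : (0 < k)%N)
    (z : 'I_n -> 'I_k) :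
  [/\ markov_basis (Amx z) (minimal_moves z),
      (forall g : 'cV[int]_#|{: edge n}|,
         kerZ (Amx z) g -> g <> 0 -> 4 <= norm1 g) &
      minimal_moves z =
        [set g | [/\ kerZ (Amx z) g, g <> 0 &
                     forall h : 'cV[int]_#|{: edge n}|,
                       kerZ (Amx z) h -> h <> 0 -> norm1 g <= norm1 h]]].
Proof.
split; last 1 first.
- apply/seteqP; split=> [g [kg g4]|g [kg g0 ming]].
    split=> // [g0|h kh h0]; first by move: g4; rewrite g0 norm1_0.
    by rewrite g4; apply: ker_norm1_ge4 kh h0.
  split=> //; apply/eqP; rewrite eq_le (ker_norm1_ge4 kg g0) andbT.
  have [h [kh h4]] := ker_minimal_move kg g0; rewrite -h4; apply: ming => // h0.
  by move: h4; rewrite h0 norm1_0.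
- split=> [|g []//|b x y fx fy]; last exact: fiber_linked.
  by apply: (@finite_norm1_eq _ 4) => g [].
- by move=> g; apply: ker_norm1_ge4.
Qed.
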